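(* Assume that $q$ is not a root of unity. Then there exists an isomorphism of $\mathbb F$-algebras $Z(\hat H_q)\to\mathbb F[\lambda_0,\lambda_1,\lambda_2,\lambda_3]$ that sends $T_i\mapsto\lambda_i$ for $0\leq i\leq 3$, where $Z(\hat H_q)$ is the center of $\hat H_q$.
   Context: Algebras are associative with multiplicative identity $1$. $\mathbb F$ is a field and $q\in\mathbb F$ is nonzero with $q^4\neq 1$. $\lambda_0,\lambda_1,\lambda_2,\lambda_3$ are mutually commuting indeterminates. The universal DAHA of type $(C_1^\vee,C_1)$, denoted $\hat H_q$, is the $\mathbb F$-algebra defined by generators $t_i^{\pm1}$ ($i\in\{0,1,2,3\}$) and relations: (i) $t_it_i^{-1}=t_i^{-1}t_i=1$ for each $i$; (ii) $t_i+t_i^{-1}$ is central for each $i$; (iii) $t_0t_1t_2t_3=q^{-1}$. Define $T_i=t_i+t_i^{-1}\in\hat H_q$ for $i\in\{0,1,2,3\}$. *)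

(* Defs.v *)
From HB Require Import structures.
From mathcomp Require Import all_boot all_order all_algebra boolp.
From mathcomp Require Import generic_quotient ring_quotient.
From mathcomp Require monalg.

Set Implicit Arguments.
Unset Strict Implicit.
Unset Printing Implicit Defensive.

Import GRing.Theory.
Local Open Scope ring_scope.
Local Open Scope quotient_scope.

Section Center.
Variables (F : fieldType) (A : algType F).

Definition central : {pred A} := fun z => `[< forall x : A, GRing.comm z x >].

Lemma centralP z : reflect (forall x, z * x = x * z) (z \in central).
Proof. exact: asboolP. Qed.

Fact central_subalg_closed : subalg_closed central.
Proof.
split=> [|a u v|u v]; rewrite ?(mul1r, mulr1).
- by apply/centralP => x; rewrite mul1r mulr1.
- move=> /centralP cu /centralP cv; apply/centralP => x.
  by rewrite mulrDl mulrDr -scalerAl -scalerAr cu cv.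
- move=> /centralP cu /centralP cv; apply/centralP => x.
  by rewrite -mulrA cv mulrA cu mulrA.
Qed.
HB.instance Definition _ := GRing.isSubalgClosed.Build F A central
  central_subalg_closed.

Record center := Center { center_val :> A; center_valP : center_val \in central }.

HB.instance Definition _ := [isSub for center_val].
HB.instance Definition _ := [Choice of center by <:].
HB.instance Definition _ := [SubChoice_isSubAlgebra of center by <:].
End Center.

Section TwoSidedIdeal.
Variables (A : nzRingType) (rel : A -> Prop).

(* The two-sided ideal of A generated by the elements satisfying rel. *)
Inductive in_ideal : A -> Prop :=
| InIdeal_gen x : rel x -> in_ideal x
| InIdeal0 : in_ideal 0
| InIdealB x y : in_ideal x -> in_ideal y -> in_ideal (x - y)
| InIdealMl a x : in_ideal x -> in_ideal (a * x)
| InIdealMr x a : in_ideal x -> in_ideal (x * a).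

Definition ideal_of : {pred A} := fun x => `[< in_ideal x >].

Lemma ideal_ofP x : reflect (in_ideal x) (x \in ideal_of).
Proof. exact: asboolP. Qed.

Fact ideal_of_zmod_closed : zmod_closed ideal_of.
Proof.
split=> [|x y /ideal_ofP Ix /ideal_ofP Iy]; apply/ideal_ofP.
  exact: InIdeal0.
exact: InIdealB.
Qed.
HB.instance Definition _ := GRing.isZmodClosed.Build A ideal_of
  ideal_of_zmod_closed.
End TwoSidedIdeal.

(* The quotient of A by the two-sided ideal generated by rel. The additive
   quotient is {ideal_quot _}; the library only gives it a product when A is
   commutative. The argument one_notin is needed because algebras in the library
   are nontrivial. *)
Section QuotientAlgebra.
Variables (F : fieldType) (A : algType F) (rel : A -> Prop).
Variable one_notin : ~ in_ideal rel 1.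

Definition quot_alg of (~ in_ideal rel 1) := {ideal_quot (ideal_of rel)}.
Local Notation Q := (quot_alg one_notin).

HB.instance Definition _ := GRing.Zmodule.on Q.

Definition quot_pi (x : A) : Q := \pi_({ideal_quot (ideal_of rel)}) x.
Local Notation rep := (fun x : Q => repr (x : {ideal_quot (ideal_of rel)})).

Lemma quot_piK (x : Q) : quot_pi (rep x) = x.
Proof. exact: reprK. Qed.

Lemma quot_piE x y : (quot_pi x = quot_pi y) <-> in_ideal rel (x - y).
Proof.
split=> [/eqP|Ixy]; first by rewrite -Quotient.idealrBE => /ideal_ofP.
by apply/eqP; rewrite -Quotient.idealrBE; apply/ideal_ofP.
Qed.

Lemma quot_piB x y : quot_pi (x - y) = quot_pi x - quot_pi y.
Proof. exact: (raddfB (\pi_({ideal_quot (ideal_of rel)}))). Qed.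

Lemma quot_piD x y : quot_pi (x + y) = quot_pi x + quot_pi y.
Proof. exact: (raddfD (\pi_({ideal_quot (ideal_of rel)}))). Qed.

Definition quot_one : Q := quot_pi 1.
Definition quot_mul (x y : Q) : Q := quot_pi (rep x * rep y).
Definition quot_scale (a : F) (x : Q) : Q := quot_pi (a *: rep x).

Lemma rep_pi x : in_ideal rel (rep (quot_pi x) - x).
Proof. by apply/quot_piE; rewrite quot_piK. Qed.

Lemma quot_mulE x y : quot_mul (quot_pi x) (quot_pi y) = quot_pi (x * y).
Proof.
apply/quot_piE; set x' := rep _; set y' := rep _.
have -> : x' * y' - x * y = (x' - x) * y' - x * (y - y').
  by rewrite mulrBl mulrBr opprB addrA subrK.
apply: InIdealB; first by apply: InIdealMr; exact: rep_pi.
by apply: InIdealMl; rewrite -opprB -sub0r; apply: InIdealB (rep_pi _);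
  exact: InIdeal0.
Qed.

Lemma quot_scaleE a x : quot_scale a (quot_pi x) = quot_pi (a *: x).
Proof.
apply/quot_piE; rewrite -scalerBr -mulr_algl; apply: InIdealMl; exact: rep_pi.
Qed.

Lemma quot_ind (P : Q -> Prop) : (forall x, P (quot_pi x)) -> forall x, P x.
Proof. by move=> Ppi x; rewrite -(quot_piK x). Qed.

Fact quot_mulA : associative quot_mul.
Proof.
elim/quot_ind=> x; elim/quot_ind=> y; elim/quot_ind=> z.
by rewrite !quot_mulE mulrA.
Qed.

Fact quot_1mul : left_id quot_one quot_mul.
Proof. by elim/quot_ind=> x; rewrite quot_mulE mul1r. Qed.

Fact quot_mul1 : right_id quot_one quot_mul.
Proof. by elim/quot_ind=> x; rewrite quot_mulE mulr1. Qed.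

Fact quot_mulDl : left_distributive quot_mul +%R.
Proof.
elim/quot_ind=> x; elim/quot_ind=> y; elim/quot_ind=> z.
by rewrite -quot_piD !quot_mulE -quot_piD mulrDl.
Qed.

Fact quot_mulDr : right_distributive quot_mul +%R.
Proof.
elim/quot_ind=> x; elim/quot_ind=> y; elim/quot_ind=> z.
by rewrite -quot_piD !quot_mulE -quot_piD mulrDr.
Qed.

Fact quot_1neq0 : quot_one != 0.
Proof.
apply/eqP=> e; apply: one_notin; rewrite -[1]subr0; apply/quot_piE.
by rewrite [LHS]e -[in RHS](subrr 0) quot_piB subrr.
Qed.

HB.instance Definition _ := GRing.Zmodule_isNzRing.Build Q
  quot_mulA quot_1mul quot_mul1 quot_mulDl quot_mulDr quot_1neq0.

Fact quot_scaleA a b x :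
  quot_scale a (quot_scale b x) = quot_scale (a * b) x.
Proof. by elim/quot_ind: x => x; rewrite !quot_scaleE scalerA. Qed.

Fact quot_scale1 : left_id 1 quot_scale.
Proof. by elim/quot_ind=> x; rewrite quot_scaleE scale1r. Qed.

Fact quot_scaleDr : right_distributive quot_scale +%R.
Proof.
move=> a; elim/quot_ind=> x; elim/quot_ind=> y.
by rewrite -quot_piD !quot_scaleE -quot_piD scalerDr.
Qed.

Fact quot_scaleDl x : {morph quot_scale^~ x : a b / a + b}.
Proof.
by move=> a b; elim/quot_ind: x => x; rewrite !quot_scaleE -quot_piD scalerDl.
Qed.

HB.instance Definition _ := GRing.Zmodule_isLmodule.Build F Q
  quot_scaleA quot_scale1 quot_scaleDr quot_scaleDl.

Fact quot_scaleAl a (x y : Q) : a *: (x * y) = (a *: x) * y.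
Proof.
elim/quot_ind: x => x; elim/quot_ind: y => y.
rewrite -[_ *: _]/(quot_scale _ (quot_mul _ _)).
rewrite -[RHS]/(quot_mul (quot_scale _ _) _).
by rewrite quot_mulE !quot_scaleE quot_mulE scalerAl.
Qed.

HB.instance Definition _ := GRing.Lmodule_isLalgebra.Build F Q quot_scaleAl.

Fact quot_scaleAr a (x y : Q) : a *: (x * y) = x * (a *: y).
Proof.
elim/quot_ind: x => x; elim/quot_ind: y => y.
rewrite -[_ *: _]/(quot_scale _ (quot_mul _ _)).
rewrite -[RHS]/(quot_mul _ (quot_scale _ _)).
by rewrite quot_mulE !quot_scaleE quot_mulE scalerAr.
Qed.

HB.instance Definition _ := GRing.Lalgebra_isAlgebra.Build F Q quot_scaleAr.

Fact quot_pi_zmod_morphism : zmod_morphism quot_pi.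
Proof. exact: quot_piB. Qed.
HB.instance Definition _ := GRing.isZmodMorphism.Build A Q quot_pi
  quot_pi_zmod_morphism.

Fact quot_pi_monoid_morphism : monoid_morphism quot_pi.
Proof. by split=> // x y; rewrite -quot_mulE. Qed.
HB.instance Definition _ := GRing.isMonoidMorphism.Build A Q quot_pi
  quot_pi_monoid_morphism.

Fact quot_pi_scalable : scalable quot_pi.
Proof. by move=> a x; rewrite -quot_scaleE. Qed.
HB.instance Definition _ := GRing.isScalable.Build F A Q *:%R quot_pi
  quot_pi_scalable.
End QuotientAlgebra.

(* The free (noncommutative) F-algebra on X: the monoid algebra of the free
   monoid on X. *)
Section FreeAlgebra.
Import monalg.
Variables (F : fieldType) (X : choiceType).

Definition free_alg := {malg F[{fmonom X}]}.
HB.instance Definition _ := GRing.Lalgebra.on free_alg.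

Definition free_gen (x : X) : free_alg := << fmu x >>.

Fact free_scaleAr a (u v : free_alg) : a *: (u * v) = u * (a *: v).
Proof.
suff Ca (w : free_alg) : a *: w = w * a%:MP.
  by rewrite !Ca mulrA.
rewrite -mul_malgC !malgM_def fgmulUg fgmulgU.
by apply: eq_bigr => k _; rewrite mulrC mul1m mulm1.
Qed.

HB.instance Definition _ := GRing.Lalgebra_isAlgebra.Build F free_alg
  free_scaleAr.

(* The algebra morphism that sends the generator x to h x. *)
Section Eval.
Variables (B : algType F) (h : X -> B).

Definition word_eval (w : {fmonom X}) : B := \prod_(x <- fmonom_val w) h x.

Fact word_eval_mmorphism : mmorphism word_eval.
Proof.
split=> [v w|]; rewrite /word_eval ?fm1 ?big_nil //.
by rewrite fmM big_cat.
Qed.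
HB.instance Definition _ := isMultiplicative.Build {fmonom X} B word_eval
  word_eval_mmorphism.

Definition free_eval (u : free_alg) : B := mmap (in_alg B) word_eval u.

Lemma free_eval_gen x : free_eval (free_gen x) = h x.
Proof. by rewrite /free_eval mmapU /= scale1r mul1r /word_eval fmU big_seq1. Qed.

Fact free_eval_nmod_morphism : nmod_morphism free_eval.
Proof. by split; [exact: mmap0 | exact: mmapD]. Qed.
HB.instance Definition _ := GRing.isNmodMorphism.Build free_alg B free_eval
  free_eval_nmod_morphism.

Fact free_eval_monoid_morphism : monoid_morphism free_eval.
Proof.
have [eM e1] : multiplicative (mmap (in_alg B) word_eval).
  apply: commr_mmap_is_multiplicative => g m m'.
  by rewrite /GRing.comm /= mulr_algl mulr_algr.
by split.
Qed.
HB.instance Definition _ := GRing.isMonoidMorphism.Build free_alg B free_eval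
  free_eval_monoid_morphism.

Fact free_eval_scalable : scalable free_eval.
Proof. by move=> a u; rewrite /free_eval mmapZ /= mulr_algl. Qed.
HB.instance Definition _ := GRing.isScalable.Build F free_alg B *:%R free_eval
  free_eval_scalable.
End Eval.
End FreeAlgebra.

Section UniversalDAHA.
Variables (F : fieldType) (q : F).

Definition daha_free := free_alg F ('I_4 * bool)%type.
HB.instance Definition _ := GRing.Algebra.on daha_free.

(* The letters for t_i and for t_i^{-1}. *)
Definition letter (i : 'I_4) : daha_free := free_gen F (i, false).
Definition letterV (i : 'I_4) : daha_free := free_gen F (i, true).

(* The relations u = v of the presentation, as elements u - v. The product over
   i < 4 is the ordered product t_0 t_1 t_2 t_3. *)
Inductive daha_rel : daha_free -> Prop :=
| DahaMulV i : daha_rel (letter i * letterV i - 1)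
| DahaVMul i : daha_rel (letterV i * letter i - 1)
| DahaCentral i u : daha_rel ((letter i + letterV i) * u
                              - u * (letter i + letterV i))
| DahaProd : daha_rel (\prod_(i < 4) letter i - (q^-1)%:A).

Hypothesis q_neq0 : q != 0.

(* Under t_0 |-> q^-1 and t_i |-> 1 for i > 0 all the relations hold in F. *)
Fact daha_nontrivial : ~ in_ideal daha_rel 1.
Proof.
pose h (x : 'I_4 * bool) : F^o :=
  if x.1 == ord0 then (if x.2 then q else q^-1) else 1.
pose e : {lrmorphism daha_free -> F^o} := free_eval h.
have eE i : e (letter i) = h (i, false) by exact: free_eval_gen.
have eVE i : e (letterV i) = h (i, true) by exact: free_eval_gen.
suff e0 x : in_ideal daha_rel x -> e x = 0.
  by move=> /e0 /eqP; rewrite rmorph1 oner_eq0.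
elim=> [_ [i|i|i u|]||y z _ ey _ ez|a y _ ey|y a _ ey].
- rewrite rmorphB rmorphM rmorph1 /= eE eVE /h /=.
  by case: ifP => _; rewrite ?mulVf ?mulr1 ?subrr.
- rewrite rmorphB rmorphM rmorph1 /= eE eVE /h /=.
  by case: ifP => _; rewrite ?mulfV ?mulr1 ?subrr.
- by rewrite rmorphB !rmorphM /= mulrC subrr.
- have eA : e (q^-1)%:A = q^-1 by rewrite -[RHS]mulr1; exact: rmorph_alg.
  rewrite rmorphB rmorph_prod; apply/eqP; rewrite subr_eq0; apply/eqP.
  rewrite !big_ord_recl big_ord0 /= !eE /h /= !mulr1.
  exact: esym eA.
- exact: rmorph0.
- by rewrite rmorphB /= ey ez subrr.
- by rewrite rmorphM /= ey mulr0.
- by rewrite rmorphM /= ey mul0r.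
Qed.

Definition daha := quot_alg daha_nontrivial.
HB.instance Definition _ := GRing.Algebra.on daha.

Definition daha_t (i : 'I_4) : daha := quot_pi daha_nontrivial (letter i).
Definition daha_tV (i : 'I_4) : daha := quot_pi daha_nontrivial (letterV i).

Definition daha_T (i : 'I_4) : daha := daha_t i + daha_tV i.

Fact daha_T_central i : daha_T i \in central (A := daha).
Proof.
apply/centralP; elim/quot_ind=> u.
rewrite /daha_T -[_ + _]quot_piD -!(rmorphM (quot_pi daha_nontrivial)).
by apply/quot_piE; apply: InIdeal_gen; exact: DahaCentral.
Qed.

Definition daha_center := center daha.
HB.instance Definition _ := GRing.Algebra.on daha_center.

Definition daha_center_T (i : 'I_4) : daha_center := Center (daha_T_central i).
End UniversalDAHA.

(* Main.v *)
From HB Require Import structures.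
Require Import Defs.
From mathcomp Require Import all_boot all_order all_algebra mpoly.
From mathcomp Require monalg.
From mathcomp Require Import generic_quotient ring_quotient.
From mathcomp Require Import boolp functions.
From mathcomp Require Import zify ring.

(** The algebra is spanned by simple elements, a concrete module tells these
    elements apart, and a central element must look the same everywhere on that
    module.

    Put X = t_3 t_0. Then t_3 = X t_0^-1 and t_2 = q^-1 t_1^-1 X^-1, so X, t_0
    and t_1 generate the algebra together with their inverses. That T_3 and T_2
    are central says how t_0 and t_1 move past X: up to Laurent polynomials in
    X over F[T_0, .., T_3], the letter t_0 replaces X by X^-1 and t_1 replaces
    X by q^-2 X^-1 ([hecke_laurent]). Since t_a^2 = T_a t_a - 1, every element
    is a combination of alternating words in t_0 and t_1 with such Laurent
    polynomials as left coefficients ([word_span_exists]).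

    The module consists of the functions on the integers with values in the
    field K of fractions of F[l_0, .., l_3]. There X multiplies by a sequence
    x_m that runs through the orbit of l_0 under the two reflections z |-> z^-1
    and z |-> q^-2 z^-1. The letter t_0 mixes the values at 2k and 2k+1, the
    letter t_1 those at 2k-1 and 2k. Such a 2 x 2 block must have determinant
    1, and the traces prescribed by the values of two of the T_i determine its
    diagonal, so the relations can be solved explicitly
    ([principal_series]). Each T_i acts as l_i, which makes the T_i
    algebraically independent.

    As q is not a root of unity, the x_m are distinct, so a central element z
    acts diagonally, because it commutes with X. In z, written with words of
    length at most k + 1, the only word that relates row m to column m + k + 1
    is the one of full length whose first letter points upwards at m, and it
    does so with coefficient 1. Its Laurent coefficient therefore vanishes at
    infinitely many x_m, hence it is zero ([central_descent]). Down the lengths,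
    z is a Laurent polynomial in X. Commutation with t_0 and t_1 makes its value
    independent of m, so it is a constant, an element of F[T_0, .., T_3]
    ([central_poly]). *)

Set Implicit Arguments.
Unset Strict Implicit.
Unset Printing Implicit Defensive.

Import Order.TTheory GRing.Theory Num.Theory.
Local Open Scope ring_scope.

(** * Working with the presentation *)

Local Notation i0 := (@Ordinal 4 0 isT).
Local Notation i1 := (@Ordinal 4 1 isT).
Local Notation i2 := (@Ordinal 4 2 isT).
Local Notation i3 := (@Ordinal 4 3 isT).

Section QuotientLift.
Variables (F : fieldType) (A B : algType F) (rel : A -> Prop).
Variable one_notin : ~ in_ideal rel 1.
Variable e : {lrmorphism A -> B}.
Hypothesis e_rel : forall x, rel x -> e x = 0.

Lemma in_ideal_ker x : in_ideal rel x -> e x = 0.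
Proof.
elim=> {x} [x /e_rel //||x y _ ex _ ey|a x _ ex|x a _ ex].
- exact: rmorph0.
- by rewrite rmorphB /= ex ey subrr.
- by rewrite rmorphM /= ex mulr0.
- by rewrite rmorphM /= ex mul0r.
Qed.

(** The universal property of the quotient, which turns operators that satisfy
    the relations into a module. *)
Lemma quot_lift_exists : exists r : {lrmorphism quot_alg one_notin -> B},
  forall x, r (quot_pi one_notin x) = e x.
Proof.
pose r (z : quot_alg one_notin) : B :=
  e (repr (z : {ideal_quot (ideal_of rel)})).
have rE x : r (quot_pi one_notin x) = e x.
  apply/eqP; rewrite -subr_eq0 -rmorphB; apply/eqP/in_ideal_ker.
  exact: rep_pi.
have rB : zmod_morphism r.
  elim/quot_ind=> x; elim/quot_ind=> y.
  by rewrite -raddfB !rE raddfB.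
have rM : monoid_morphism r.
  split; first by rewrite -(rmorph1 (quot_pi one_notin)) rE rmorph1.
  elim/quot_ind=> x; elim/quot_ind=> y.
  by rewrite -rmorphM !rE rmorphM.
have rZ : scalable r.
  move=> a; elim/quot_ind=> x.
  by rewrite -linearZ !rE linearZ.
pose r1 := GRing.isZmodMorphism.Build _ _ r rB.
pose r2 := GRing.isMonoidMorphism.Build _ _ r rM.
pose r3 := GRing.isScalable.Build F _ _ *:%R r rZ.
pose rr : {lrmorphism quot_alg one_notin -> B} := HB.pack r r1 r2 r3.
by exists rr.
Qed.
End QuotientLift.

Section FreeAlgebraInduction.
Import monalg.
Variables (F : fieldType) (X : choiceType).

Lemma free_alg_ind (P : free_alg F X -> Prop) :
  P 1 -> (forall u v, P u -> P v -> P (u + v)) ->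
  (forall c u, P u -> P (c *: u)) ->
  (forall x u, P u -> P (free_gen F x * u)) -> forall u, P u.
Proof.
move=> P1 PD PZ Pg u.
have P0 : P 0 by rewrite -(scale0r 1); exact: PZ.
rewrite (monalgE u); apply: (big_ind P) => // w _.
have -> : mkmalgU w (mcoeff w u) =
  mcoeff w u *: (mkmalgU w 1 : free_alg F X) :> free_alg F X.
  by apply/malgP=> k; rewrite mcoeffZ !mcoeffU mulr_natr.
apply: PZ.
case: w => s /=.
elim: s => [|x s IHs]; first by rewrite -fmoneE.
have -> : mkmalgU (FMonom (x :: s)) 1 =
   free_gen F x * mkmalgU (FMonom s) 1 :> free_alg F X.
  rewrite malgM_def /free_gen fgmulUU mulr1.
  by congr mkmalgU; rewrite fmuE -[RHS]fmK fmM.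
exact: Pg.
Qed.
End FreeAlgebraInduction.

Section DahaPresentation.
Variables (F : fieldType) (q : F) (q_neq0 : q != 0).
Local Notation H := (daha q_neq0).
Local Notation t := (daha_t q_neq0).
Local Notation tV := (daha_tV q_neq0).
Local Notation pi := (quot_pi (daha_nontrivial q_neq0)).

Lemma daha_ind (P : H -> Prop) :
  P 1 -> (forall x y, P x -> P y -> P (x + y)) ->
  (forall c x, P x -> P (c *: x)) ->
  (forall i x, P x -> P (t i * x)) -> (forall i x, P x -> P (tV i * x)) ->
  forall x, P x.
Proof.
move=> P1 PD PZ Pt PV; elim/quot_ind; elim/free_alg_ind.
- exact: P1.
- by move=> u v Pu Pv; rewrite raddfD; apply: PD.
- move=> c u Pu.
  have -> : pi (c *: u) = c *: pi u by exact: linearZ_LR.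
  exact: PZ.
- move=> [i b] u Pu; case: b.
    rewrite -quot_mulE; exact: PV.
  rewrite -quot_mulE; exact: Pt.
Qed.

Lemma piM a b : pi a * pi b = pi (a * b) :> H.
Proof. exact: quot_mulE. Qed.

Lemma piZ c (a : daha_free F) : pi (c *: a) = c *: pi a :> H.
Proof. exact: linearZ_LR. Qed.

Lemma daha_tK i : t i * tV i = 1.
Proof. rewrite piM; apply/quot_piE; apply: InIdeal_gen; exact: DahaMulV. Qed.

Lemma daha_tVK i : tV i * t i = 1.
Proof. rewrite piM; apply/quot_piE; apply: InIdeal_gen; exact: DahaVMul. Qed.

Lemma daha_t_prod : t i0 * t i1 * t i2 * t i3 = (q^-1)%:A.
Proof.
have /InIdeal_gen/(quot_piE (daha_nontrivial q_neq0)) := DahaProd q.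
rewrite !big_ord_recl big_ord0 mulr1.
have -> : ord0 = i0 :> 'I_4 by exact: val_inj.
have -> : lift i0 ord0 = i1 by exact: val_inj.
have -> : lift i0 (lift ord0 ord0) = i2 by exact: val_inj.
have -> : lift i0 (lift ord0 (lift ord0 ord0)) = i3 by exact: val_inj.
move=> e; rewrite -!mulrA /daha_t.
rewrite (piM (letter F i2)) (piM (letter F i1)) (piM (letter F i0)) e.
exact: piZ.
Qed.
End DahaPresentation.

Section PolynomialInT.
Variables (F : fieldType) (q : F) (q_neq0 : q != 0).
Local Notation H := (daha q_neq0).

Lemma daha_T_comm i x : daha_T q_neq0 i * x = x * daha_T q_neq0 i.
Proof. exact/centralP/daha_T_central. Qed.

(** Evaluation of polynomials at the T_i; the inverse of the isomorphism that is
    wanted. *)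
Lemma poly_in_T : exists E : {lrmorphism {mpoly F[4]} -> H},
  (forall i, E 'X_i = daha_T q_neq0 i) /\ (forall p x, E p * x = x * E p).
Proof.
pose e : {mpoly F[4]} -> H := mmap (in_alg H) (daha_T q_neq0).
have eM : monoid_morphism e.
  have [eM e1] : multiplicative e.
    apply: commr_mmap_is_multiplicative => [i x|p m m'].
      exact: esym (daha_T_comm i x).
    by rewrite /GRing.comm /= mulr_algl mulr_algr.
  by split.
have eZ : scalable e by move=> c p; rewrite /e mmapZ /= mulr_algl.
pose e1 := GRing.isZmodMorphism.Build _ _ e
  (raddfB (mmap (in_alg H) (daha_T q_neq0))).
pose e2 := GRing.isMonoidMorphism.Build _ _ e eM.
pose e3 := GRing.isScalable.Build F _ _ *:%R e eZ.
pose E : {lrmorphism {mpoly F[4]} -> H} := HB.pack e e1 e2 e3.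
exists E; split=> [i|p]; first by rewrite /= /e mmapX mmap1U.
suff /centralP : E p \in @central F H by [].
rewrite /= /e /mmap rpred_sum // => m _; rewrite rpredM //.
  by apply: rpredZ; exact: rpred1.
by apply: rpred_prod => i _; apply: rpredX; exact: daha_T_central.
Qed.
End PolynomialInT.

(** * A spanning family of words *)

(** The hypothesis is the trace relation Y s^-1 + s Y^-1 = S, with T - s for
    the inverse of s. It is solved for s Y^-1 at once, and for s Y after
    multiplication by Y^-1 on the left and Y on the right, which does not change
    the central element S. *)
Lemma reflection_swap (A : nzRingType) (s T S Y YV : A) :
  (forall x, T * x = x * T) -> (forall x, S * x = x * S) ->
  Y * YV = 1 -> YV * Y = 1 -> Y * (T - s) + s * YV = S ->
  s * YV = Y * s + (S - Y * T) /\ s * Y = YV * s + (T * Y - S).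
Proof.
move=> Tc Sc YK YVK eS; split.
  by rewrite -eS mulrBr addrAC [Y * T - _]addrC addrK addNKr.
have eT : (T - s) * Y + YV * s = S.
  rewrite -[RHS]mulr1 -YVK mulrA Sc -eS mulrDr mulrDl !mulrA YVK mul1r.
  by rewrite -[in RHS]mulrA YVK mulr1.
rewrite -eT mulrBl opprD [T * Y + _]addrA subKr.
by rewrite addrCA subrr addr0.
Qed.

Section Spanning.
Variables (F : fieldType) (q : F) (q_neq0 : q != 0).
Variables (A : algType F) (t tV : 'I_4 -> A).
Variable E : {lrmorphism {mpoly F[4]} -> A}.
Hypothesis tK : forall i, t i * tV i = 1.
Hypothesis tVK : forall i, tV i * t i = 1.
Hypothesis t_prod : t i0 * t i1 * t i2 * t i3 = q^-1%:A.
Hypothesis E_central : forall p x, E p * x = x * E p.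
Hypothesis E_X : forall i, E 'X_i = t i + tV i.

Variables X XV : A.
Hypothesis XE : X = t i3 * t i0.
Hypothesis XVE : XV = tV i0 * tV i3.

Lemma X_mul_XV : X * XV = 1.
Proof. by rewrite XE XVE mulrA -(mulrA (t i3)) tK mulr1. Qed.
Lemma XV_mul_X : XV * X = 1.
Proof. by rewrite XE XVE mulrA -(mulrA (tV i0)) tVK mulr1. Qed.

Lemma tVE i : tV i = E 'X_i - t i.
Proof. by rewrite E_X addrC addKr. Qed.

Lemma t3E : t i3 = X * tV i0.
Proof. by rewrite XE -mulrA tK mulr1. Qed.
Lemma tV3E : tV i3 = t i0 * XV.
Proof. by rewrite XVE mulrA tK mul1r. Qed.

(** The defining product relation, cyclically permuted. *)
Lemma t12X : t i1 * t i2 * X = q^-1%:A.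
Proof.
have -> : t i1 * t i2 * X = tV i0 * (t i0 * t i1 * t i2 * t i3) * t i0.
  by rewrite XE !mulrA tVK mul1r.
by rewrite t_prod mulr_algr -scalerAl tVK.
Qed.

Lemma t2E : t i2 = q^-1 *: (tV i1 * XV).
Proof.
have -> : t i2 = tV i1 * (t i1 * t i2 * X) * XV.
  by rewrite !mulrA tVK mul1r -mulrA X_mul_XV mulr1.
by rewrite t12X mulr_algr -scalerAl.
Qed.

Lemma tV2E : tV i2 = q *: (X * t i1).
Proof.
rewrite -[RHS]mul1r -(tVK i2) t2E -mulrA -scalerAl -!scalerAr scalerA mulVf //.
by rewrite scale1r (mulrA (_ * XV)) -(mulrA (tV i1)) XV_mul_X mulr1 tVK mulr1.
Qed.

(** The letters t_0 and t_1 are indexed by booleans, so that negation alternates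
    between them. *)
Definition hecke (a : bool) := if a then t i1 else t i0.
Definition hecke_index (a : bool) : 'I_4 := if a then i1 else i0.

(** The Laurent polynomials in X over F[T_0, .., T_3], given as a closure so that
    moving a letter past all of them is a single induction. *)
Inductive laurent : A -> Prop :=
| LaurentC p : laurent (E p)
| LaurentX : laurent X
| LaurentXV : laurent XV
| LaurentD x y : laurent x -> laurent y -> laurent (x + y)
| LaurentM x y : laurent x -> laurent y -> laurent (x * y).

Lemma laurentZ c x : laurent x -> laurent (c *: x).
Proof.
rewrite -mulr_algl -[c%:A](rmorph_alg E); exact/LaurentM/LaurentC.
Qed.

Lemma laurentB x y : laurent x -> laurent y -> laurent (x - y).
Proof.
by move=> Lx Ly; rewrite -scaleN1r; apply: LaurentD => //; exact: laurentZ.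
Qed.

Lemma hecke_quadratic a :
  hecke a * hecke a = E 'X_(hecke_index a) * hecke a - 1.
Proof.
by case: a; rewrite /hecke /hecke_index E_X mulrDl tVK addrK.
Qed.

(** Both cases are instances of [reflection_swap]: for t_0 with Y = X and S = T_3,
    for t_1 with Y = q^-1 X^-1 and S = T_2. *)
Lemma hecke_X a : exists p1 p2 r1 r2, [/\ laurent p1, laurent p2,
   laurent r1, laurent r2 & hecke a * X = p1 * hecke a + p2 /\
   hecke a * XV = r1 * hecke a + r2].
Proof.
case: a; rewrite /hecke.
- have eS : (q^-1 *: XV) * (E 'X_i1 - t i1) + t i1 * (q *: X) = E 'X_i2.
    (* Here t_2 = t_1^-1 Y has its factors in the other order, which the
       conjugation by t_1 repairs without changing the trace. *)
    have -> : E 'X_i2 = t i1 * E 'X_i2 * tV i1.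
      by rewrite -E_central -mulrA tK mulr1.
    rewrite -tVE E_X t2E tV2E mulrDr mulrDl -!(scalerAr, scalerAl).
    rewrite (mulrA (t i1) (tV i1)) tK mul1r (mulrA (t i1) X).
    by rewrite -(mulrA _ (t i1)) tK mulr1.
  have [||e1 e2] := reflection_swap (E_central _) (E_central _) _ _ eS.
  + by rewrite -scalerAl -scalerAr scalerA mulVf // scale1r XV_mul_X.
  + by rewrite -scalerAl -scalerAr scalerA mulfV // scale1r X_mul_XV.
  exists (q^-1 *: (q^-1 *: XV)), (q^-1 *: (E 'X_i2 - (q^-1 *: XV) * E 'X_i1)).
  exists (q *: (q *: X)), (q *: (E 'X_i1 * (q^-1 *: XV) - E 'X_i2)).
  split; try by do ?[apply: laurentZ | apply: laurentB | apply: LaurentM |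
    exact: LaurentC | exact: LaurentX | exact: LaurentXV].
  have -> : t i1 * X = q^-1 *: (t i1 * (q *: X)).
    by rewrite -scalerAr scalerA mulVf // scale1r.
  have -> : t i1 * XV = q *: (t i1 * (q^-1 *: XV)).
    by rewrite -scalerAr scalerA mulfV // scale1r.
  by rewrite e1 e2 !scalerDr -!(scalerAl _ _ (t i1)).
- have eS : X * (E 'X_i0 - t i0) + t i0 * XV = E 'X_i3.
    by rewrite -tVE -t3E -tV3E E_X.
  have [e1 e2] :=
    reflection_swap (E_central _) (E_central _) X_mul_XV XV_mul_X eS.
  exists XV, (E 'X_i0 * X - E 'X_i3), X, (E 'X_i3 - X * E 'X_i0).
  split=> //; try by do ?[apply: laurentB | apply: LaurentM |
    exact: LaurentC | exact: LaurentX | exact: LaurentXV].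
Qed.

Lemma hecke_laurent a z : laurent z -> exists z1 z2,
  [/\ laurent z1, laurent z2 & hecke a * z = z1 * hecke a + z2].
Proof.
have [p1 [p2 [r1 [r2 [Lp1 Lp2 Lr1 Lr2 [eX eXV]]]]]] := hecke_X a.
elim=> {z} [p|||x y _ [x1 [x2 [L1 L2 ex]]] _ [y1 [y2 [M1 M2 ey]]]|
            x y _ [x1 [x2 [L1 L2 ex]]] Ly [y1 [y2 [M1 M2 ey]]]].
- exists (E p), (E 0); split; [exact: LaurentC|exact: LaurentC|].
  by rewrite rmorph0 addr0 E_central.
- by exists p1, p2.
- by exists r1, r2.
- exists (x1 + y1), (x2 + y2); split; [exact: LaurentD|exact: LaurentD|].
  by rewrite mulrDr ex ey mulrDl addrACA.
- exists (x1 * y1), (x1 * y2 + x2 * y).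
  split; [exact: LaurentM|apply: LaurentD; exact: LaurentM|].
  by rewrite mulrA ex mulrDl -mulrA ey mulrDr !mulrA addrA.
Qed.

(** The alternating word of length k whose leftmost letter is t_a. *)
Fixpoint word a k := if k is k'.+1 then hecke a * word (~~ a) k' else 1.

(** The combinations of words of length at most k, top length split off: this is
    the form in which the coefficients are killed one length at a time. *)
Fixpoint word_span k z :=
  if k is k'.+1 then exists y p0 p1,
    [/\ word_span k' y, laurent p0, laurent p1 &
        z = y + (p0 * word false k + p1 * word true k)]
  else laurent z.

Lemma laurent0 : laurent 0. Proof. rewrite -(rmorph0 E); exact: LaurentC. Qed.
Lemma laurent1 : laurent 1. Proof. rewrite -(rmorph1 E); exact: LaurentC. Qed.

Lemma word_span_leS k z : word_span k z -> word_span k.+1 z.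
Proof.
move=> sz; exists z, 0, 0; split=> //; try exact: laurent0.
by rewrite !mul0r !addr0.
Qed.

Lemma word_span_le k l z : (k <= l)%N -> word_span k z -> word_span l z.
Proof.
move=> /subnK <-; elim: (l - k)%N => // n IHn sz.
by rewrite addSn; apply/word_span_leS/IHn.
Qed.

Lemma word_spanD k x y : word_span k x -> word_span k y -> word_span k (x + y).
Proof.
elim: k x y => [|k IHk] x y; first exact: LaurentD.
move=> [x' [p0 [p1 [sx Lp0 Lp1 ->]]]] [y' [r0 [r1 [sy Lr0 Lr1 ->]]]].
exists (x' + y'), (p0 + r0), (p1 + r1); split; try exact: LaurentD.
  exact: IHk.
by rewrite [LHS]addrACA; congr (_ + _); rewrite addrACA -!mulrDl.
Qed.

Lemma word_spanMl k p x : laurent p -> word_span k x -> word_span k (p * x).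
Proof.
move=> Lp; elim: k x => [|k IHk] x; first exact: LaurentM.
move=> [x' [p0 [p1 [sx Lp0 Lp1 ->]]]].
exists (p * x'), (p * p0), (p * p1); split; try exact: LaurentM.
  exact: IHk.
by rewrite !mulrDr !mulrA.
Qed.

Lemma word_span_word k a p : laurent p -> word_span k (p * word a k).
Proof.
case: k => [|k] Lp; first by rewrite mulr1.
exists 0, (if a then 0 else p), (if a then p else 0).
split; try by case: a => //; exact: laurent0.
  by apply: (@word_span_le 0) => //; exact: laurent0.
by rewrite add0r; case: a; rewrite mul0r ?add0r ?addr0.
Qed.

(** A letter passes through the coefficient and then either lengthens the word or
    meets itself, where the quadratic relation shortens it. *)
Lemma word_span_hecke k a x : word_span k x -> word_span k.+1 (hecke a * x).
Proof.
elim: k x => [|k IHk] x.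
  move=> /(hecke_laurent a) [x1 [x2 [L1 L2 ->]]]; apply: word_spanD.
    by rewrite -[hecke a]mulr1; exact: (word_span_word 1).
  exact: word_span_leS.
move=> [y [p0 [p1 [sy Lp0 Lp1 ->]]]].
rewrite mulrDr; apply: word_spanD; first exact/word_span_leS/IHk.
suff W b p : laurent p -> word_span k.+2 (hecke a * (p * word b k.+1)).
  by rewrite mulrDr; apply: word_spanD; exact: W.
move=> /(hecke_laurent a) [r1 [r2 [L1 L2]]]; rewrite mulrA => ->.
rewrite mulrDl; apply: word_spanD; last exact/word_span_leS/word_span_word.
rewrite -mulrA; have [eb|nb] := eqVneq a b; last first.
  have -> : b = ~~ a by move: (a) (b) nb => [] [].
  exact: (word_span_word k.+2 a).
rewrite eb [word b _]/= (mulrA (hecke b)) hecke_quadratic mulrBl mul1r mulrBr.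
rewrite -scaleN1r scalerAl.
apply: word_spanD.
  rewrite -(mulrA (E _)) (mulrA r1); apply: word_span_leS.
  apply: (word_span_word k.+1 b).
  exact/LaurentM/LaurentC.
by apply/word_span_leS/word_span_leS/word_span_word/laurentZ.
Qed.

Hypothesis A_ind : forall P : A -> Prop,
  P 1 -> (forall x y, P x -> P y -> P (x + y)) ->
  (forall c x, P x -> P (c *: x)) ->
  (forall i x, P x -> P (t i * x)) -> (forall i x, P x -> P (tV i * x)) ->
  forall x, P x.

Lemma word_span_exists x : exists k, word_span k x.
Proof.
have sL p y : laurent p -> (exists k, word_span k y) ->
    exists k, word_span k (p * y).
  by move=> Lp [k sy]; exists k; exact: word_spanMl.
have sD y z : (exists k, word_span k y) -> (exists k, word_span k z) ->
    exists k, word_span k (y + z).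
  move=> [k sy] [l sz]; exists (k + l)%N.
  by apply: word_spanD; [apply: word_span_le sy|apply: word_span_le sz];
    rewrite ?leq_addr ?leq_addl.
have sZ c y : (exists k, word_span k y) -> exists k, word_span k (c *: y).
  move=> sy; rewrite -mulr_algl; apply: sL sy.
  rewrite -(rmorph_alg E); exact: LaurentC.
have sR a y : (exists k, word_span k y) -> exists k, word_span k (hecke a * y).
  by move=> [k sy]; exists k.+1; exact: word_span_hecke.
have sRV a y : (exists k, word_span k y) ->
    exists k, word_span k ((E 'X_(hecke_index a) - hecke a) * y).
  move=> sy; rewrite mulrBl -scaleN1r; apply: sD.
    by apply: sL => //; exact: LaurentC.
  exact/sZ/sR.
have LX := LaurentX; have LXV := LaurentXV.
move: x; apply: (A_ind (P := fun x => exists k, word_span k x)) => //.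
- by exists 0; exact: laurent1.
- move=> i x sx; case: i => [] [|[|[|[|//]]]] lt_i.
  + rewrite (_ : Ordinal _ = i0); last exact: val_inj.
    exact: (sR false).
  + rewrite (_ : Ordinal _ = i1); last exact: val_inj.
    exact: (sR true).
  + rewrite (_ : Ordinal _ = i2); last exact: val_inj.
    rewrite t2E -scalerAl -mulrA tVE; apply: sZ; apply: (sRV true).
    exact: sL.
  + rewrite (_ : Ordinal _ = i3); last exact: val_inj.
    rewrite t3E -mulrA tVE; apply: sL => //; exact: (sRV false).
- move=> i x sx; case: i => [] [|[|[|[|//]]]] lt_i.
  + rewrite (_ : Ordinal _ = i0); last exact: val_inj.
    rewrite tVE; exact: (sRV false).
  + rewrite (_ : Ordinal _ = i1); last exact: val_inj.
    rewrite tVE; exact: (sRV true).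
  + rewrite (_ : Ordinal _ = i2); last exact: val_inj.
    rewrite tV2E -scalerAl -mulrA; apply: sZ; apply: sL => //; exact: (sR true).
  + rewrite (_ : Ordinal _ = i3); last exact: val_inj.
    rewrite tV3E -mulrA; apply: (sR false); exact: sL.
Qed.

End Spanning.

Section LaurentForm.
Variables (F : fieldType) (A : algType F) (E : {lrmorphism {mpoly F[4]} -> A}).
Hypothesis E_central : forall p x, E p * x = x * E p.
Variables X XV : A.
Hypothesis XVK : XV * X = 1.
Local Notation laurent := (laurent E X XV).

Lemma X_commr : commr_rmorph E X.
Proof. by move=> p; rewrite /GRing.comm E_central. Qed.

Definition poly_at := horner_morph X_commr.
HB.instance Definition _ := GRing.RMorphism.on poly_at.

(** Clearing denominators, which reduces questions about coefficients to roots of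
    ordinary polynomials. *)
Lemma laurent_poly z : laurent z -> exists N p, z * X ^+ N = poly_at p.
Proof.
elim=> {z} [p|||x y _ [N [p ex]] _ [M [r ey]]|x y _ [N [p ex]] _ [M [r ey]]].
- by exists 0, p%:P; rewrite expr0 mulr1 [RHS]horner_morphC.
- by exists 0, 'X; rewrite expr0 mulr1 [RHS]horner_morphX.
- by exists 1, 1; rewrite expr1 XVK [RHS]rmorph1.
- exists (N + M)%N, (p * 'X^M + r * 'X^N).
  rewrite mulrDl {2}addnC !exprD !mulrA ex ey.
  by rewrite /poly_at rmorphD !rmorphM !rmorphXn /= horner_morphX.
- exists (M + N)%N, (p * r).
  rewrite exprD -mulrA (mulrA y) ey.
  have -> : poly_at r * X ^+ N = X ^+ N * poly_at r.
    by rewrite -(horner_morphX X_commr) -rmorphXn -!rmorphM mulrC.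
  by rewrite mulrA ex -rmorphM.
Qed.
End LaurentForm.

(** * Linear operators on functions on the integers *)

Section LinearOperators.
Variables (K : fieldType).

(** Functions on an orbit of the infinite dihedral group generated by the two
    reflections; the orbit is enumerated by the integers so that the reflections
    exchange neighbours. *)
Definition orbit_space := int -> K^o.
HB.instance Definition _ := GRing.Lmodule.copy orbit_space (int -> K^o).
Local Notation V := orbit_space.

Definition linop_pred : {pred V -> V} := fun f => `[< linear f >].

Lemma linop_predP (f : V -> V) : reflect (linear f) (f \in linop_pred).
Proof. exact: asboolP. Qed.

Fact linop_zmod_closed : zmod_closed linop_pred.
Proof.
split=> [|f g /linop_predP lf /linop_predP lg]; apply/linop_predP=> a u v.
  by rewrite scaler0 addr0.
by rewrite -!/(f _ - g _) [LHS]/(f _ - g _) lf lg scalerBr opprD addrACA.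
Qed.
HB.instance Definition _ := GRing.isZmodClosed.Build (V -> V) linop_pred
  linop_zmod_closed.

(** Operators are linear over the large field K, so that multiplication by an
    element of K is central among them; they form an algebra over the small field
    F, whose scalars act through iota. *)
Record linop (F : fieldType) (iota : {rmorphism F -> K}) :=
  Linop { linop_fun :> V -> V; linop_funP : linop_fun \in linop_pred }.

Variables (F : fieldType) (iota : {rmorphism F -> K}).
Local Notation L := (linop iota).

HB.instance Definition _ := [isSub for @linop_fun F iota].
HB.instance Definition _ := [Choice of L by <:].
HB.instance Definition _ := [SubChoice_isSubZmodule of L by <:].

Lemma linop_linear (f : L) : linear f.
Proof. exact/linop_predP/linop_funP. Qed.

HB.instance Definition _ (f : L) :=
  GRing.isLinear.Build K V V *:%R (linop_fun f) (linop_linear f).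

Lemma linopP (f g : L) : (forall v, f v = g v) -> f = g.
Proof. by move=> fg; apply/val_inj/funext. Qed.

Fact linop_one_subproof : id \in linop_pred.
Proof. by apply/linop_predP. Qed.
Definition linop_one : L := Linop iota linop_one_subproof.

Fact linop_mul_subproof (f g : L) : f \o g \in linop_pred.
Proof. by apply/linop_predP=> a u v; rewrite /= !linearP. Qed.
Definition linop_mul (f g : L) : L := Linop iota (linop_mul_subproof f g).

Fact linop_scale_subproof (c : F) (f : L) :
  (fun v => iota c *: f v) \in linop_pred.
Proof.
apply/linop_predP=> a u v.
by rewrite linearP scalerDr !scalerA mulrC.
Qed.
Definition linop_scale c f : L := Linop iota (linop_scale_subproof c f).

Fact linop_mulA : associative linop_mul.
Proof. by move=> f g h; apply: linopP. Qed.
Fact linop_1mul : left_id linop_one linop_mul.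
Proof. by move=> f; apply: linopP. Qed.
Fact linop_mul1 : right_id linop_one linop_mul.
Proof. by move=> f; apply: linopP. Qed.
Fact linop_mulDl : left_distributive linop_mul +%R.
Proof. by move=> f g h; apply: linopP. Qed.
Fact linop_mulDr : right_distributive linop_mul +%R.
Proof.
move=> f g h; apply: linopP => v.
exact: (linearD f (g v) (h v)).
Qed.
Fact linop_1neq0 : linop_one != 0.
Proof.
apply/eqP=> /(congr1 (fun f : L => f (fun=> 1) 0)) /= /eqP.
by apply/negP; exact: oner_neq0.
Qed.
HB.instance Definition _ := GRing.Zmodule_isNzRing.Build L
  linop_mulA linop_1mul linop_mul1 linop_mulDl linop_mulDr linop_1neq0.

Fact linop_scaleA a b f :
  linop_scale a (linop_scale b f) = linop_scale (a * b) f.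
Proof. by apply: linopP => v /=; rewrite scalerA rmorphM. Qed.
Fact linop_scale1 : left_id 1 linop_scale.
Proof. by move=> f; apply: linopP => v /=; rewrite rmorph1 scale1r. Qed.
Fact linop_scaleDr : right_distributive linop_scale +%R.
Proof.
move=> a f g; apply: linopP => v; exact: (scalerDr (iota a) (f v) (g v)).
Qed.
Fact linop_scaleDl f : {morph linop_scale^~ f : a b / a + b}.
Proof.
move=> a b; apply: linopP => v; rewrite /= rmorphD.
exact: (scalerDl (f v) (iota a) (iota b)).
Qed.
HB.instance Definition _ := GRing.Zmodule_isLmodule.Build F L
  linop_scaleA linop_scale1 linop_scaleDr linop_scaleDl.

Fact linop_scaleAl a (f g : L) : a *: (f * g) = (a *: f) * g.
Proof. by apply: linopP. Qed.
HB.instance Definition _ := GRing.Lmodule_isLalgebra.Build F L linop_scaleAl.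

Fact linop_scaleAr a (f g : L) : a *: (f * g) = f * (a *: g).
Proof. apply: linopP => v; exact: esym (linearZ_LR f (iota a) (g v)). Qed.
HB.instance Definition _ := GRing.Lalgebra_isAlgebra.Build F L linop_scaleAr.

Lemma linopM (f g : L) v : (f * g) v = f (g v). Proof. by []. Qed.
Lemma linop1 v : (1 : L) v = v. Proof. by []. Qed.
Lemma linopZ a (f : L) v m : (a *: f) v m = iota a * f v m. Proof. by []. Qed.
End LinearOperators.

(** * The principal series module *)

Section Diagonal.
Variables (F K : fieldType) (iota : {rmorphism F -> K}).
Local Notation L := (linop iota).
Local Notation V := (orbit_space K).

Fact diag_subproof (d : int -> K) :
  (fun (v : V) m => d m * v m) \in @linop_pred K.
Proof.
by apply/linop_predP=> a u v; apply/funext=> m; rewrite mulrDr mulrCA.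
Qed.
Definition diag d : L := Linop iota (diag_subproof d).

Lemma diagM d e : diag d * diag e = diag (fun m => d m * e m).
Proof. by apply: linopP => v; apply/funext=> m; apply: mulrA. Qed.

Lemma diag1 d : (forall m, d m = 1) -> diag d = 1.
Proof.
by move=> d1; apply: linopP => v; apply/funext=> m; rewrite /= d1 mul1r.
Qed.

Definition scal (c : K) : L := diag (fun=> c).

Fact scal_zmod_morphism : zmod_morphism scal.
Proof.
by move=> a b; apply: linopP => v; apply/funext=> m; apply: mulrBl.
Qed.
HB.instance Definition _ := GRing.isZmodMorphism.Build K L scal
  scal_zmod_morphism.

Fact scal_monoid_morphism : monoid_morphism scal.
Proof. by split=> [|a b]; [exact: diag1 | exact: esym (diagM _ _)]. Qed.
HB.instance Definition _ := GRing.isMonoidMorphism.Build K L scal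
  scal_monoid_morphism.

Lemma scal_central c (f : L) : scal c * f = f * scal c.
Proof. apply: linopP => v; exact: esym (linearZ_LR f c v). Qed.
End Diagonal.

Definition parity (m : int) : bool := odd `|m|%N.
(** The neighbour with which the letter t_a pairs the integer m: t_0 pairs 2k with
    2k+1, and t_1 pairs 2k-1 with 2k. *)
Definition step (a : bool) (m : int) : int :=
  if parity m == a then m + 1 else m - 1.

Lemma parityD1 m : parity (m + 1) = ~~ parity m.
Proof. rewrite /parity; lia. Qed.
Lemma parityB1 m : parity (m - 1) = ~~ parity m.
Proof. rewrite /parity; lia. Qed.

Lemma parity_step a m : parity (step a m) = ~~ parity m.
Proof. by rewrite /step; case: ifP; rewrite (parityD1, parityB1). Qed.

Lemma stepK a : involutive (step a).
Proof.
move=> m; rewrite {1}/step parity_step /step.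
by case: (parity m) a => [] [] /=; rewrite (addrK, subrK).
Qed.

(** A 2 x 2 matrix t with diagonal a(y), a(y^-1), paired with diag(y, y^-1), has
    trace T and makes diag(y, y^-1) t^-1 have trace S. These two linear equations
    determine the diagonal, and this is their solution. *)
Lemma reflection_coef (K : fieldType) (T S y y' : K) :
  y * y' = 1 -> y ^+ 2 != 1 ->
  let a := fun z : K => (T * z - S) * z / (z ^+ 2 - 1) in
  a y + a y' = T /\ y * a y' + y^-1 * a y = S.
Proof.
move=> yy' y21 a.
have y0 : y != 0.
  by apply: contra_eq_neq yy' => ->; rewrite mul0r eq_sym oner_neq0.
have -> : y' = y^-1 by apply: (mulfI y0); rewrite yy' mulfV.
have d0 : y ^+ 2 - 1 != 0 by rewrite subr_eq0.
have d1 : 1 - y ^+ 2 != 0 by rewrite -opprB oppr_eq0.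
rewrite /a; split; field; rewrite ?y0 ?mulN1r ?d0 ?d1 //.
Qed.

Section PrincipalSeries.
Variables (F : fieldType) (q : F) (q_neq0 : q != 0).
Variables (K : fieldType) (iota : {rmorphism F -> K}).
Variables (tau : 'I_4 -> K) (x : int -> K).
Hypothesis x_neq0 : forall m, x m != 0.
Hypothesis x_inj : injective x.
Hypothesis x_step :
  forall m, x m * x (m + 1) = if parity m then (iota q) ^- 2 else 1.
Local Notation L := (linop iota).
Local Notation V := (orbit_space K).

(** The eigenvalues of t_3 t_0 = X for t_0, and those of t_1 t_2 = q^-1 X^-1 for
    t_1: with these the letters t_0 and t_1 satisfy relations of the same form. *)
Definition coord (a : bool) m := if a then (iota q * x m)^-1 else x m.

Let Q0 : iota q != 0. Proof. by rewrite fmorph_eq0. Qed.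

Lemma coord_step a m : coord a m * coord a (step a m) = 1.
Proof.
suff H n : parity n = a -> coord a n * coord a (n + 1) = 1.
  rewrite /step; case: eqP => [|/eqP pm]; first exact: H.
  rewrite mulrC -{2}(subrK 1 m) H // parityB1.
  by move: (parity m) (a) pm => [] [].
move=> pn; rewrite /coord; have := x_step n; rewrite pn; case: (a) => // e.
by rewrite -invfM mulrACA e -expr2 mulfV ?invr1 // expf_neq0.
Qed.

Lemma step_neq a m : step a m != m.
Proof. rewrite /step; case: ifP => _; lia. Qed.

Lemma coord_inj a : injective (coord a).
Proof.
move=> m n; rewrite /coord; case: a; last exact: x_inj.
by move=> /invr_inj /(mulfI Q0) /x_inj.
Qed.

Lemma coord_neq0 a m : coord a m != 0.
Proof. by rewrite /coord; case: a; rewrite ?invr_eq0 ?mulf_neq0. Qed.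

(** A denominator of the reflection could vanish only at a fixed point of it. *)
Lemma coord_sqr a m : coord a m ^+ 2 != 1.
Proof.
rewrite -(coord_step a m) expr2 (inj_eq (mulfI (coord_neq0 a m))).
by rewrite (inj_eq (@coord_inj a)) eq_sym step_neq.
Qed.

Definition traceT (a : bool) := tau (if a then i1 else i0).
Definition traceS (a : bool) := tau (if a then i2 else i3).

Definition alpha a m : K := let y := coord a m in
  (traceT a * y - traceS a) * y / (y ^+ 2 - 1).

Lemma alphaT a m : alpha a m + alpha a (step a m) = traceT a.
Proof.
by have [] := reflection_coef (traceT a) (traceS a) (coord_step a m)
  (coord_sqr a m).
Qed.

Lemma alphaS a m : coord a m * alpha a (step a m) +
   (coord a m)^-1 * alpha a m = traceS a.
Proof.
by have [] := reflection_coef (traceT a) (traceS a) (coord_step a m)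
  (coord_sqr a m).
Qed.

(** A block has determinant 1, which fixes only the product of its two
    off-diagonal entries. The one that points upwards is normalised to 1, so
    that words have leading coefficient 1 in that direction. *)
Definition beta a m : K :=
  if parity m == a then 1 else alpha a m * alpha a (step a m) - 1.

Lemma betaE a m :
  beta a m * beta a (step a m) = alpha a m * alpha a (step a m) - 1.
Proof.
rewrite /beta parity_step stepK.
by case: (parity m) a => [] [] /=; rewrite ?mul1r ?mulr1 // mulrC.
Qed.

Fact hecke_op_subproof a :
  (fun (v : V) m => alpha a m * v m + beta a m * v (step a m))
  \in @linop_pred K.
Proof.
apply/linop_predP=> c u v; apply/funext=> m.
rewrite -[LHS]/(alpha a m * (c * u m + v m) +
  beta a m * (c * u (step a m) + v (step a m))).
rewrite -[RHS]/(c * (alpha a m * u m + beta a m * u (step a m)) +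
  (alpha a m * v m + beta a m * v (step a m))).
by rewrite !mulrDr addrACA !(mulrCA c).
Qed.
Definition hecke_op a : L := Linop iota (hecke_op_subproof a).
(** By Cayley-Hamilton, the inverse of a block of determinant 1 is its trace minus
    the block. *)
Definition hecke_opV a : L := scal iota (traceT a) - hecke_op a.

Lemma hecke_opE a (v : V) m :
  hecke_op a v m = alpha a m * v m + beta a m * v (step a m).
Proof. by []. Qed.

Lemma hecke_opVE a (v : V) m :
  hecke_opV a v m = alpha a (step a m) * v m - beta a m * v (step a m).
Proof.
rewrite -[LHS]/(traceT a * v m - hecke_op a v m) hecke_opE -(alphaT a m).
ring.
Qed.

Lemma hecke_opK a : hecke_op a * hecke_opV a = 1.
Proof.
apply: linopP => v; apply/funext=> m; rewrite linopM linop1.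
rewrite hecke_opE !hecke_opVE stepK.
transitivity ((alpha a m * alpha a (step a m) -
  beta a m * beta a (step a m)) * v m); first by ring.
by rewrite betaE opprB addrC subrK mul1r.
Qed.

Lemma hecke_opVK a : hecke_opV a * hecke_op a = 1.
Proof. by rewrite mulrBl scal_central -mulrBr hecke_opK. Qed.

Definition posX : L := diag iota x.
Definition posXV : L := diag iota (fun m => (x m)^-1).

Lemma posXK : posX * posXV = 1.
Proof. by rewrite diagM diag1 // => m; rewrite mulfV. Qed.
Lemma posXVK : posXV * posX = 1.
Proof. by rewrite diagM diag1 // => m; rewrite mulVf. Qed.

Definition gen (b : 'I_4 * bool) : L :=
  match val b.1, b.2 with
  | 0%N, false => hecke_op false
  | 0%N, true => hecke_opV false
  | 1%N, false => hecke_op true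
  | 1%N, true => hecke_opV true
  | 2%N, false => q^-1 *: (hecke_opV true * posXV)
  | 2%N, true => q *: (posX * hecke_op true)
  | _, false => posX * hecke_opV false
  | _, true => hecke_op false * posXV
  end.

Lemma mulr_cancel_mid (a b c d : L) : a * b = 1 -> c * d = 1 ->
   (c * a) * (b * d) = 1.
Proof. by move=> ab cd; rewrite mulrA -(mulrA c) ab mulr1. Qed.

Lemma genK i : gen (i, false) * gen (i, true) = 1.
Proof.
case: i => [] [|[|[|[|//]]]] ? /=; rewrite /gen /=; try exact: hecke_opK.
- rewrite -scalerAl -scalerAr scalerA mulVf // scale1r.
  by apply: mulr_cancel_mid; rewrite ?hecke_opVK ?posXVK.
- by apply: mulr_cancel_mid; rewrite ?hecke_opVK ?posXK.
Qed.

Lemma genVK i : gen (i, true) * gen (i, false) = 1.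
Proof.
case: i => [] [|[|[|[|//]]]] ? /=; rewrite /gen /=; try exact: hecke_opVK.
- rewrite -scalerAl -scalerAr scalerA mulfV // scale1r.
  by apply: mulr_cancel_mid; rewrite ?hecke_opK ?posXK.
- by apply: mulr_cancel_mid; rewrite ?hecke_opK ?posXVK.
Qed.

Lemma hecke_op_trace2 :
  q^-1 *: (hecke_opV true * posXV) + q *: (posX * hecke_op true) =
  scal iota (tau i2).
Proof.
apply: linopP => v; apply/funext=> m.
rewrite -[LHS]/(iota q^-1 * hecke_opV true (fun n => (x n)^-1 * v n) m
  + iota q * (x m * hecke_op true v m)).
rewrite hecke_opVE hecke_opE -[RHS]/(traceS true * v m) -(alphaS true m) /coord.
have e := coord_step true m.
have -> : (x (step true m))^-1 = (iota q) ^+ 2 * x m.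
  move: e; rewrite /coord -invfM => /(congr1 (@GRing.inv K)).
  rewrite invrK invr1 => e.
  apply: (mulfI (x_neq0 (step true m))); rewrite mulfV // -e; ring.
rewrite fmorphV.
field.
by rewrite Q0 x_neq0 oner_neq0.
Qed.

Lemma hecke_op_trace3 :
  posX * hecke_opV false + hecke_op false * posXV = scal iota (tau i3).
Proof.
apply: linopP => v; apply/funext=> m.
rewrite -[LHS]/(x m * hecke_opV false v m +
  hecke_op false (fun n => (x n)^-1 * v n) m).
rewrite hecke_opVE hecke_opE -[RHS]/(traceS false * v m) -(alphaS false m).
rewrite /coord.
have -> : (x (step false m))^-1 = x m.
  by apply: (mulIf (x_neq0 (step false m)));
     rewrite mulVf // [RHS](coord_step false m).
ring.
Qed.

Lemma gen_trace i : gen (i, false) + gen (i, true) = scal iota (tau i).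
Proof.
case: i => [] [|[|[|[|//]]]] lt_i /=; rewrite /gen /=.
- by rewrite addrC subrK; congr (scal _ (tau _)); apply: val_inj.
- by rewrite addrC subrK; congr (scal _ (tau _)); apply: val_inj.
- by rewrite hecke_op_trace2; congr (scal _ (tau _)); apply: val_inj.
- by rewrite hecke_op_trace3; congr (scal _ (tau _)); apply: val_inj.
Qed.

Lemma gen_prod : \prod_(i < 4) gen (i, false) = (q^-1)%:A.
Proof.
rewrite !big_ord_recl big_ord0 mulr1 /gen /=.
rewrite -scalerAl -scalerAr -scalerAr; congr (_ *: _).
rewrite -!mulrA (mulrA posXV) posXVK mul1r.
rewrite (mulrA (hecke_op true)) hecke_opK mul1r.
exact: hecke_opK.
Qed.

Lemma principal_series : exists r : {lrmorphism daha q_neq0 -> L},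
  [/\ forall i, r (daha_T q_neq0 i) = scal iota (tau i),
      forall a, r (hecke (daha_t q_neq0) a) = hecke_op a,
      r (daha_t q_neq0 i3 * daha_t q_neq0 i0) = posX &
      r (daha_tV q_neq0 i0 * daha_tV q_neq0 i3) = posXV].
Proof.
pose e : {lrmorphism daha_free F -> L} := free_eval gen.
have eE i : e (letter F i) = gen (i, false) by exact: free_eval_gen.
have eVE i : e (letterV F i) = gen (i, true) by exact: free_eval_gen.
have e_rel u : daha_rel q u -> e u = 0.
  case=> {u} [i|i|i u|].
  - by rewrite rmorphB rmorphM rmorph1 /= eE eVE genK subrr.
  - by rewrite rmorphB rmorphM rmorph1 /= eE eVE genVK subrr.
  - rewrite rmorphB !rmorphM rmorphD /= eE eVE gen_trace scal_central.
    by rewrite subrr.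
  - rewrite rmorphB rmorph_prod /= (eq_bigr _ (fun i _ => eE i)) gen_prod.
    by rewrite rmorph_alg subrr.
have [r rE] := quot_lift_exists (daha_nontrivial q_neq0) e_rel.
have rt i : r (daha_t q_neq0 i) = gen (i, false) by rewrite -eE; exact: rE.
have rtV i : r (daha_tV q_neq0 i) = gen (i, true) by rewrite -eVE; exact: rE.
exists r; split.
- by move=> i; rewrite -gen_trace -rt -rtV; exact: raddfD.
- by case; exact: rt.
- transitivity (gen (i3, false) * gen (i0, false)).
    by rewrite -!rt; exact: rmorphM.
  by rewrite /gen /= -mulrA hecke_opVK mulr1.
- transitivity (gen (i0, true) * gen (i3, true)).
    by rewrite -!rtV; exact: rmorphM.
  by rewrite /gen /= mulrA hecke_opVK mul1r.
Qed.
End PrincipalSeries.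

(** * Central elements *)

Lemma poly_inj_roots (K : fieldType) (p : {poly K}) (f : nat -> K) :
  injective f -> (forall k, p.[f k] = 0) -> p = 0.
Proof.
move=> f_inj pf; apply/eqP; apply: contraT => p0.
have := max_poly_roots p0 (rs := map f (iota 0 (size p))).
rewrite size_map size_iota ltnn (map_inj_uniq f_inj) iota_uniq => -> //.
by apply/allP=> _ /mapP[k _ ->]; apply/eqP/pf.
Qed.

Section CentralElements.
Variables (F : fieldType) (K : fieldType) (iota : {rmorphism F -> K}).
Variables (A : algType F) (t : 'I_4 -> A).
Variable E : {lrmorphism {mpoly F[4]} -> A}.
Hypothesis E_central : forall p x, E p * x = x * E p.
Variables X XV : A.
Hypothesis XK : X * XV = 1.
Hypothesis XVK : XV * X = 1.
Variables (emb : {rmorphism {mpoly F[4]} -> K}) (x : int -> K).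
Hypothesis emb_inj : injective emb.
Hypothesis x_inj : injective x.
Variable r : {lrmorphism A -> linop iota}.
Variables (alpha beta : bool -> int -> K).
Hypothesis rX : forall v m, r X v m = x m * v m.
Hypothesis rXV : forall v m, r XV v m = (x m)^-1 * v m.
Hypothesis rE : forall p v m, r (E p) v m = emb p * v m.
Hypothesis r_hecke : forall a v m,
  r (hecke t a) v m = alpha a m * v m + beta a m * v (step a m).
Hypothesis beta1 : forall a m, parity m = a -> beta a m = 1.
Hypothesis span_all : forall z, exists k, word_span t E X XV k z.

Local Notation laurent := (laurent E X XV).
Local Notation word_span := (word_span t E X XV).
Local Notation word := (word t).

Lemma rM a b v m : r (a * b) v m = r a (r b v) m.
Proof. by rewrite rmorphM. Qed.
Lemma rD a b v m : r (a + b) v m = r a v m + r b v m.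
Proof. by rewrite rmorphD. Qed.

Lemma laurent_diag z : laurent z ->
  exists d, forall v m, r z v m = d m * v m.
Proof.
elim=> {z} [p|||y z _ [d ed] _ [e ee]|y z _ [d ed] _ [e ee]].
- by exists (fun=> emb p).
- by exists x.
- by exists (fun m => (x m)^-1).
- by exists (fun m => d m + e m) => v m; rewrite rD ed ee mulrDl.
- by exists (fun m => d m * e m) => v m; rewrite rM ed ee mulrA.
Qed.

Local Notation hX := (poly_at E_central X).

Lemma rpolyX p v m : r (hX p) v m = (map_poly emb p).[x m] * v m.
Proof.
elim/poly_ind: p v m => [|p c IHp] v m.
  by rewrite !rmorph0 horner0 mul0r.
have -> : hX (p * 'X + c%:P) = hX p * X + E c.
  by rewrite rmorphD rmorphM /= [hX 'X]horner_morphX [hX c%:P]horner_morphC.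
rewrite rD rM IHp rX rE rmorphD rmorphM /= map_polyX map_polyC /= !hornerE.
by rewrite /= mulrDl.
Qed.

Lemma XnK N : X ^+ N * XV ^+ N = 1.
Proof.
elim: N => [|N IHN]; first by rewrite mulr1.
by rewrite exprSr exprS mulrA -(mulrA _ X) XK mulr1.
Qed.

Lemma rXn N v m : r (X ^+ N) v m = x m ^+ N * v m.
Proof.
elim: N v m => [|N IHN] v m; first by rewrite rmorph1 mul1r.
by rewrite !exprS rM rX IHN mulrA.
Qed.

Definition delta (n : int) : orbit_space K := fun m => (m == n)%:R.

(** A Laurent polynomial with infinitely many roots among the distinct x_m is
    zero. *)
Lemma laurent_eq0 z (f : nat -> int) : laurent z -> injective f ->
  (forall k, r z (delta (f k)) (f k) = 0) -> z = 0.
Proof.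
move=> Lz f_inj z0; have [N [p ep]] := laurent_poly E_central XVK Lz.
suff p0 : p = 0.
  by rewrite -[z]mulr1 -(XnK N) mulrA ep p0 rmorph0 mul0r.
suff /(map_inj_poly emb_inj (rmorph0 _)) :
  map_poly emb p = map_poly emb 0 by [].
rewrite rmorph0; apply: (@poly_inj_roots _ _ (x \o f)).
  exact: inj_comp.
move=> k /=; have [d ed] := laurent_diag Lz.
have := rpolyX p (delta (f k)) (f k).
rewrite -ep rM ed rXn mulrCA -ed z0 mulr0 /delta eqxx mulr1 => <- //.
Qed.

Lemma step_le a m : (step a m <= m + 1)%R.
Proof. rewrite /step; case: ifP => _; lia. Qed.

(** Each letter moves a row by at most one, so a word of length k sees only the
    columns up to m + k from row m. *)
Lemma word_below k a (n : int) (v : orbit_space K) m :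
  (forall j, (j < n)%R -> v j = 0) -> (m + k%:Z < n)%R -> r (word a k) v m = 0.
Proof.
move=> v0; elim: k a m => [|k IHk] a m lt_mn /=.
  by rewrite rmorph1; apply: v0; lia.
rewrite rM r_hecke !IHk; [by rewrite !mulr0 addr0| |lia].
have := step_le a m; lia.
Qed.

(** If the leftmost letter points upwards at m, so do all the following ones along
    the way, because parities and letters both alternate. *)
Lemma word_towards k a (m : int) (v : orbit_space K) : parity m = a ->
  (forall j, (j < m + k%:Z)%R -> v j = 0) -> r (word a k) v m = v (m + k%:Z).
Proof.
elim: k a m => [|k IHk] a m pm v0 /=; first by rewrite rmorph1 addr0.
rewrite rM r_hecke (@word_below _ _ (m + k.+1%:Z)) //; last lia.
rewrite mulr0 add0r beta1 // mul1r /step pm eqxx IHk ?parityD1 ?pm //.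
  by congr v; lia.
by move=> j lt_j; apply: v0; lia.
Qed.

(** If the leftmost letter points downwards at m, too few letters remain to reach
    the column m + k + 1. *)
Lemma word_away k a (m : int) (v : orbit_space K) : parity m = ~~ a ->
  (forall j, (j < m + k.+1%:Z)%R -> v j = 0) -> r (word a k.+1) v m = 0.
Proof.
move=> pm v0 /=; rewrite rM r_hecke !(@word_below _ _ (m + k.+1%:Z)) //.
- by rewrite !mulr0 addr0.
- by rewrite /step pm; case: (a) => /=; lia.
- lia.
Qed.

Lemma word_span_below k z (n : int) (v : orbit_space K) m : word_span k z ->
  (forall j, (j < n)%R -> v j = 0) -> (m + k%:Z < n)%R -> r z v m = 0.
Proof.
move=> + v0; elim: k z => [|k IHk] z.
  by move=> /laurent_diag[d ->] lt_m; rewrite v0 ?mulr0 //; lia.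
case=> y [p0 [p1 [sy /laurent_diag[d0 e0] /laurent_diag[d1 e1] ->]]] lt_m.
rewrite !rD !rM e0 e1 (IHk y) //; last lia.
by rewrite !(word_below _ v0) // !mulr0 !addr0.
Qed.

(** The eigenvalues of X are distinct, so what commutes with X is diagonal. *)
Lemma central_diag z m n : (forall y, z * y = y * z) -> m != n ->
  r z (delta n) m = 0.
Proof.
move=> zc mn; have /(congr1 (fun f => r f (delta n) m)) := zc X.
rewrite !rM rX.
have -> : r X (delta n) = x n *: delta n.
  apply/funext=> j; rewrite rX -[RHS]/(x n * delta n j) /delta.
  by case: eqVneq => [->|_] //; rewrite !mulr0.
have -> : r z (x n *: delta n) m = x n * r z (delta n) m by rewrite linearZ_LR.
move=> /eqP; rewrite -subr_eq0 -mulrBl.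
rewrite mulf_eq0 subr_eq0 (inj_eq x_inj) eq_sym (negPf mn) => /eqP //.
Qed.

Definition row (a : bool) (k : nat) : int := k.*2%:Z + a%:Z.

Lemma row_inj a : injective (row a).
Proof. rewrite /row => k l; lia. Qed.

Lemma parity_row a k : parity (row a k) = a.
Proof. rewrite /row /parity; case: a; lia. Qed.

(** In the rows m whose parity makes t_a point upwards, the entry of z in column
    m + k + 1 is the value at x_m of the coefficient of the word of length k + 1
    that starts with t_a. It is off the diagonal, hence zero. *)
Lemma central_descent k z :
  (forall y, z * y = y * z) -> word_span k.+1 z -> word_span k z.
Proof.
move=> zc [y [p0 [p1 [sy L0 L1 ez]]]].
have key a p p' : laurent p -> laurent p' ->
    z = y + (p * word a k.+1 + p' * word (~~ a) k.+1) -> p = 0.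
  move=> Lp Lp' e; apply: (laurent_eq0 Lp (@row_inj a)) => i.
  set m := row a i; pose n := m + k.+1%:Z.
  have pm : parity m = a by exact: parity_row.
  have v0 j : (j < m + k.+1%:Z)%R -> delta n j = 0.
    by rewrite /delta /n; case: eqVneq => // ->; rewrite ltxx.
  have mn : m != n by rewrite /n; lia.
  have := central_diag zc mn; rewrite e !rD (word_span_below sy v0); last lia.
  have [d ed] := laurent_diag Lp; have [d' ed'] := laurent_diag Lp'.
  rewrite !rM !ed !ed' word_towards // word_away ?negbK //.
  by rewrite /delta /n !eqxx mulr0 addr0 add0r.
have p00 : p0 = 0 by apply: (key false _ p1).
have p10 : p1 = 0 by apply: (key true _ p0) => //; rewrite ez [_ * _ + _]addrC.
by rewrite ez p00 p10 !mul0r !addr0.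
Qed.

Lemma central_laurent z : (forall y, z * y = y * z) -> laurent z.
Proof.
move=> zc; have [k] := span_all z.
elim: k => // k IHk /central_descent; auto.
Qed.

(** Commutation with the letter that points upwards at m compares the diagonal
    entries at m and m + 1. If these are all equal to d, then clearing
    denominators leaves a polynomial with the same values as d 'X^N. *)
Lemma central_poly z : (forall y, z * y = y * z) -> exists p, z = E p.
Proof.
move=> zc; have Lz := central_laurent zc.
have [d ed] := laurent_diag Lz.
have dS m : d (m + 1) = d m.
  pose a := parity m.
  have /(congr1 (fun f => r f (delta (m + 1)) m)) := zc (hecke t a).
  rewrite !rM r_hecke !ed r_hecke beta1 // /step eqxx /delta eqxx.
  have -> : (m == m + 1) = false by lia.
  by rewrite !mulr0 !add0r !(mulr1, mul1r) => ->.
have dk (k : nat) : d k%:Z = d 0.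
  by elim: k => // k IHk; rewrite -addn1 PoszD dS.
have [N [p ep]] := laurent_poly E_central XVK Lz.
have pN : map_poly emb p = (d 0)%:P * 'X^N.
  apply/eqP; rewrite -subr_eq0; apply/eqP.
  apply: (@poly_inj_roots _ _ (fun k : nat => x k%:Z)).
    by move=> k l /x_inj [].
  move=> k; have := rpolyX p (delta k%:Z) k%:Z.
  rewrite -ep rM ed rXn dk /delta eqxx !mulr1 !hornerE => <-.
  by rewrite subrr.
have pE : p = (p`_N)%:P * 'X^N.
  apply/polyP=> i; rewrite mul_polyC coefZ coefXn.
  have [->|iN] := eqVneq i N; first by rewrite mulr1.
  apply: emb_inj; rewrite mulr0 rmorph0 -coef_map /= pN mul_polyC coefZ coefXn.
  by rewrite (negPf iN) mulr0.
exists p`_N; rewrite -[z]mulr1 -(XnK N) mulrA ep pE rmorphM rmorphXn /=.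
rewrite /poly_at horner_morphC horner_morphX -mulrA XnK mulr1.
by rewrite coefCM coefXn eqxx mulr1.
Qed.

Lemma E_inj : injective E.
Proof.
move=> p p' /(congr1 (fun f => r f (delta 0) 0)).
by rewrite !rE /delta eqxx !mulr1 => /emb_inj.
Qed.
End CentralElements.

(** * A generic orbit *)

Lemma exprz_inj (K : fieldType) (c : K) : c != 0 ->
  (forall n : nat, (0 < n)%N -> ~~ n.-unity_root c) -> injective (exprz c).
Proof.
move=> c0 c_nroot.
have c1 (n : nat) : c ^+ n.+1 != 1.
  by have := c_nroot n.+1 isT; rewrite unity_rootE.
have cz (j : int) : c ^ j = 1 -> j = 0.
  case: j => [[|n]|n] //.
    by rewrite -exprnP => /eqP; rewrite (negPf (c1 n)).
  by rewrite NegzE -exprnN => /eqP; rewrite invr_eq1 (negPf (c1 n)).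
move=> i j e; apply/eqP; rewrite -subr_eq0; apply/eqP/cz.
by rewrite expfzDr // e -expfzDr // subrr expr0z.
Qed.

Section GenericOrbit.
Variables (F : fieldType) (q : F) (q_neq0 : q != 0).
Hypothesis q_nroot : forall n : nat, (0 < n)%N -> ~~ n.-unity_root q.
Local Notation R := {mpoly F[4]}.
Local Notation K := {fraction R}.

Definition scalar_frac : {rmorphism F -> K} := @tofrac R \o @mpolyC 4 F.
Definition indet : K := tofrac 'X_i0.

(** The orbit of the indeterminate l_0 under z |-> z^-1 and z |-> q^-2 z^-1. Any
    element of K whose square is not a power of q would do as starting point. *)
Definition position (m : int) : K :=
  scalar_frac (q ^ (if parity m then m - 1 else - m)) *
  (if parity m then indet^-1 else indet).

Lemma indet_neq0 : indet != 0.
Proof.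
rewrite tofrac_eq0; apply/eqP=> /(congr1 (meval (fun=> 1))) /eqP.
by rewrite rmorph0 mevalXU oner_eq0.
Qed.

Lemma scalar_frac_neq0 (m : int) : scalar_frac (q ^ m) != 0.
Proof. by rewrite fmorph_eq0 expfz_neq0. Qed.

Lemma position_neq0 m : position m != 0.
Proof.
rewrite mulf_neq0 ?scalar_frac_neq0 //.
by case: ifP => _; rewrite ?invr_eq0 indet_neq0.
Qed.

(** A square of an indeterminate takes both values 0 and 1, so it is not a
    constant. *)
Lemma indet_sqr c : indet ^+ 2 != scalar_frac c.
Proof.
rewrite -rmorphXn tofrac_eq; apply/eqP.
move=> /(congr1 (fun p => (p.@[fun=> 0], p.@[fun=> 1]))).
rewrite !rmorphXn /= !mevalXU !mevalC expr0n expr1n => -[<- /eqP].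
by rewrite oner_eq0.
Qed.

Lemma position_step m :
  position m * position (m + 1) = if parity m then (scalar_frac q) ^- 2 else 1.
Proof.
rewrite /position parityD1 mulrACA -rmorphM -expfzDr //.
case: (parity m) => /=.
  rewrite mulVf ?indet_neq0 // mulr1 (_ : _ + _ = - 2%:Z); last by lia.
  have e : scalar_frac (q ^+ 2) = scalar_frac q ^+ 2 by exact: rmorphXn.
  by rewrite -e -exprnN; exact: (fmorphV scalar_frac).
by rewrite mulfV ?indet_neq0 // addrK addNr rmorph1 mulr1.
Qed.

(** The ratio of two positions of equal parity is a nontrivial power of q, which is
    not 1; for opposite parities, equality would make the square of l_0 a power of
    q. *)
Lemma position_inj : injective position.
Proof.
have inj i j : scalar_frac (q ^ i) = scalar_frac (q ^ j) -> i = j.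
  by move/fmorph_inj/(exprz_inj q_neq0 q_nroot).
have odd_even i j :
    scalar_frac (q ^ i) * indet^-1 != scalar_frac (q ^ j) * indet.
  apply: contra (indet_sqr (q ^ (i - j))) => /eqP e.
  apply/eqP/(mulfI (scalar_frac_neq0 j)); rewrite expr2 mulrA -e.
  rewrite mulrVK ?unitfE ?indet_neq0 //.
  by rewrite -rmorphM -expfzDr // addrC subrK.
move=> m n; rewrite /position; case: ifP => pm; case: ifP => pn.
- by move/(mulIf (invr_neq0 indet_neq0))/inj/addIr.
- by move/eqP; rewrite (negPf (odd_even _ _)).
- by move/esym/eqP; rewrite (negPf (odd_even _ _)).
- by move/(mulIf indet_neq0)/inj/oppr_inj.
Qed.
End GenericOrbit.

(** * The centre *)

Lemma mpoly_morph_eq (n : nat) (F : fieldType) (S : nzRingType)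
    (f g : {rmorphism {mpoly F[n]} -> S}) :
  (forall c, f c%:MP = g c%:MP) -> (forall i, f 'X_i = g 'X_i) -> f =1 g.
Proof.
move=> fgC fgX; elim/mpolyind=> [|c m p _ _ IHp]; first by rewrite !rmorph0.
rewrite !rmorphD IHp; congr (_ + _); rewrite -mul_mpolyC !rmorphM fgC.
congr (_ * _); rewrite mpolyXE_id !rmorph_prod; apply: eq_bigr => i _.
by rewrite !rmorphXn fgX.
Qed.

Section CenterIso.
Variables (F : fieldType) (A : algType F) (R : comAlgType F).
Variable E : {lrmorphism R -> A}.
Hypothesis E_inj : injective E.
Hypothesis E_central : forall p x, E p * x = x * E p.
Hypothesis E_onto : forall z, (forall x, z * x = x * z) -> exists p, z = E p.

Lemma center_iso : exists phi : {lrmorphism center A -> R},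
  bijective phi /\ forall z, E (phi z) = center_val z.
Proof.
have zE (z : center A) : exists p, center_val z = E p.
  exact: (E_onto (centralP _ (center_valP z))).
pose phi z := projT1 (cid (zE z)).
have phiE z : E (phi z) = center_val z by rewrite /phi; case: cid.
have phiB : zmod_morphism phi.
  by move=> x y; apply: E_inj; rewrite rmorphB /= !phiE.
have phiM : monoid_morphism phi.
  split; first by apply: E_inj; rewrite phiE rmorph1.
  by move=> x y; apply: E_inj; rewrite rmorphM /= !phiE.
have phiZ : scalable phi.
  by move=> c x; apply: E_inj; rewrite linearZ_LR /= !phiE.
pose p1 := GRing.isZmodMorphism.Build _ _ phi phiB.
pose p2 := GRing.isMonoidMorphism.Build _ _ phi phiM.
pose p3 := GRing.isScalable.Build F _ _ *:%R phi phiZ.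
pose Phi : {lrmorphism center A -> R} := HB.pack phi p1 p2 p3.
exists Phi; split=> //.
have EC p : E p \in @central F A by apply/centralP/E_central.
exists (fun p => Center (EC p)) => [z|p].
  by apply: val_inj; rewrite /= phiE.
by apply: E_inj; rewrite phiE.
Qed.
End CenterIso.

Theorem corollary15p11 (F : fieldType) (q : F) (q_neq0 : q != 0)
    (q4_neq1 : q ^+ 4 != 1)
    (q_nroot : forall n : nat, (0 < n)%N -> ~~ n.-unity_root q) :
  exists phi : {lrmorphism daha_center q_neq0 -> {mpoly F[4]}},
    bijective phi /\
    forall i : 'I_4, phi (daha_center_T q_neq0 i) = 'X_i.
Proof.
have [E [EX Ec]] := poly_in_T q_neq0.
pose tau i : {fraction {mpoly F[4]}} := tofrac 'X_i.
have [|r [rT r_hecke rX rXV]] :=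
  @principal_series _ q q_neq0 _ (scalar_frac F) tau _ (position_neq0 q_neq0)
    (position_inj q_neq0 q_nroot).
  exact: position_step.
have rE p v m : r (E p) v m = tofrac p * v m.
  suff -> : r (E p) = scal (scalar_frac F) (tofrac p) by [].
  apply: (mpoly_morph_eq (f := r \o E)
                         (g := scal (scalar_frac F) \o @tofrac _)).
    move=> c.
    have -> : c%:MP = c *: 1 :> {mpoly F[4]} by rewrite -mul_mpolyC mulr1.
    transitivity (c *: (1 : linop (scalar_frac F))).
      by rewrite /= !linearZ_LR /= !rmorph1.
    apply: linopP => w; apply/funext=> k.
    by rewrite linopZ /= -mul_mpolyC mulr1.
  by move=> i /=; rewrite EX rT.
have tK := daha_tK q_neq0; have tVK := daha_tVK q_neq0.
have sp := word_span_exists q_neq0 tK tVK (daha_t_prod q_neq0) Ec EX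
  erefl erefl (@daha_ind F q q_neq0).
have XK := X_mul_XV tK erefl erefl.
have XVK := XV_mul_X tVK erefl erefl.
have emb_inj : injective (@tofrac {mpoly F[4]}).
  by move=> p p' /eqP; rewrite tofrac_eq => /eqP.
have E_inj := E_inj emb_inj rE.
have r_diag v m :
    r (daha_t q_neq0 i3 * daha_t q_neq0 i0) v m = position q m * v m.
  by rewrite rX.
have r_diagV v m : r (daha_tV q_neq0 i0 * daha_tV q_neq0 i3) v m =
    (position q m)^-1 * v m by rewrite rXV.
have r_step (a : bool) v m : r (hecke (daha_t q_neq0) a) v m =
    alpha q (scalar_frac F) tau (position q) a m * v m +
    beta q (scalar_frac F) tau (position q) a m * v (step a m).
  by rewrite r_hecke.
have b1 (a : bool) m : parity m = a ->
    beta q (scalar_frac F) tau (position q) a m = 1.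
  by rewrite /beta => ->; rewrite eqxx.
have E_onto := central_poly Ec XK XVK emb_inj (position_inj q_neq0 q_nroot)
  r_diag r_diagV rE r_step b1 sp.
have [phi [phi_bij phiE]] := center_iso E_inj Ec E_onto.
exists phi; split=> [|i]; first exact: phi_bij.
by apply: E_inj; rewrite phiE EX.
Qed.
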